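(* Let $a_1,\dots,a_4,p_1,\dots,p_4,x_1,\dots,x_4,q_1,\dots,q_4$ be nonzero complex numbers. Put $K:=a_1a_2a_3a_4$, $L:=(p_1p_2p_3p_4)^{1/2}$, $K_0:=x_1x_2x_3x_4$, $L_0:=(q_1q_2q_3q_4)^{1/2}$, and for an integer $k\ge-1$ $$D_k[\bar x;\bar q]:=x_1x_2(q_1q_2)^{k/2}-x_3x_4(q_3q_4)^{k/2},\qquad D_k[\bar a;\bar p]:=a_1a_2(p_1p_2)^{k/2}-a_3a_4(p_3p_4)^{k/2}.$$ Then for every integer $n\ge0$ (whenever no denominator vanishes) $$\frac{a_1}{a_2}\sum_{k=0}^{n-1}D_{k-1}[\bar a;\bar p]\Big(\frac{p_1}{p_2}\Big)^{(k-1)/2}\frac{(a_1^2/p_1;p_1)_k(x_1^2;q_1)_k}{(Kp_2/(La_2^2);L/p_2)_{k+1}(K_0/x_2^2;L_0/q_2)_k}$$ $$=1-\frac{(a_1^2/p_1;p_1)_n(x_1^2;q_1)_n}{(Kp_2/(La_2^2);L/p_2)_n(K_0/x_2^2;L_0/q_2)_n}-\frac{x_1}{x_2}\sum_{k=0}^{n-1}D_k[\bar x;\bar q]\Big(\frac{q_1}{q_2}\Big)^{k/2}\frac{(a_1^2/p_1;p_1)_{k+1}(x_1^2;q_1)_k}{(Kp_2/(La_2^2);L/p_2)_{k+1}(K_0/x_2^2;L_0/q_2)_{k+1}}.$$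
   Context: For a complex number $z$, a nonzero complex base $p$ and an integer $k\ge0$, $(z;p)_k:=\prod_{j=0}^{k-1}(1-zp^j)$. Square roots $p_i^{1/2},q_i^{1/2}$ are fixed, and every half-integer power of a product or quotient of the $p_i$ (resp. $q_i$) is understood as the corresponding product of powers of these fixed roots. *)

(* Defs.v *)
From mathcomp Require Import all_boot all_order all_algebra.
From mathcomp Require Import complex reals.

Set Implicit Arguments.
Unset Strict Implicit.
Unset Printing Implicit Defensive.

Import GRing.Theory.
Local Open Scope ring_scope.

Definition qpoch (F : fieldType) (z p : F) (k : nat) : F :=
  \prod_(0 <= j < k) (1 - z * p ^+ j).

(* Here [s1], ..., [s4] are the fixed square roots of the bases [p1], ..., [p4]:
   [(p1 p2)^(k/2)] means [(s1 * s2) ^ k].  The exponent is a signed integer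
   because [k = -1] is needed. *)
Definition Dcoef (F : fieldType) (y1 y2 y3 y4 s1 s2 s3 s4 : F) (k : int) : F :=
  y1 * y2 * (s1 * s2) ^ k - y3 * y4 * (s3 * s4) ^ k.

(* Main.v *)
Require Import Defs.
From mathcomp Require Import all_boot all_order all_algebra.
From mathcomp Require Import complex reals ring.

Import GRing.Theory.
Local Open Scope ring_scope.

(* With [U k = numa k / dena k] and [V k = numx k / denx k], both sides come from
   telescoping [U n * V n - 1] through
   [U k.+1 * V k.+1 - U k * V k = (U k.+1 - U k) * V k + U k.+1 * (V k.+1 - V k)].
   Each difference is the quotient of the Pochhammer symbols times the gap of the
   two new linear factors, and that gap factors through [Dcoef]. *)

(** Multiplying by [(s1 / s2) ^ e] turns [(s1 * s2) ^ e] into a power of [s1 ^+ 2] and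
    [(s3 * s4) ^ e] into a power of [s1 * s2 * s3 * s4 / s2 ^+ 2], so no square root of the first
    base survives. *)
Lemma Dcoef_factor (F : fieldType) (y1 y2 y3 y4 s1 s2 s3 s4 : F) (e : int) :
  y2 != 0 -> s2 != 0 ->
  y1 / y2 * (Dcoef y1 y2 y3 y4 s1 s2 s3 s4 e * (s1 / s2) ^ e) =
  y1 ^+ 2 * (s1 ^+ 2) ^ e -
  y1 * y2 * y3 * y4 / y2 ^+ 2 * (s1 * s2 * s3 * s4 / s2 ^+ 2) ^ e.
Proof.
move=> y2_neq0 s2_neq0; have s2e_neq0 : s2 ^ e != 0 by rewrite expfz_neq0.
rewrite /Dcoef !expr2 !(expfzMl, exprz_inv, invfM) -!invr_expz.
by field; rewrite y2_neq0 s2e_neq0.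
Qed.

Lemma qpochS (F : fieldType) (z p : F) k :
  qpoch z p k.+1 = qpoch z p k * (1 - z * p ^+ k).
Proof. by rewrite /qpoch big_nat_recr. Qed.

(** Over the common denominator [qpoch w r k.+1], the numerator is [qpoch z p k] times the
    difference of [1 - z * p ^+ k] and [1 - w * r ^+ k]. *)
Lemma qpoch_ratio_diff (F : fieldType) (z p w r : F) k :
  qpoch w r k.+1 != 0 ->
  qpoch z p k.+1 / qpoch w r k.+1 - qpoch z p k / qpoch w r k =
  - ((z * p ^+ k - w * r ^+ k) * (qpoch z p k / qpoch w r k.+1)).
Proof.
rewrite !qpochS mulf_eq0 negb_or => /andP[den_neq0 fac_neq0].
by field; rewrite den_neq0 fac_neq0.
Qed.

Lemma sum_by_parts (R : pzRingType) (u v : nat -> R) n :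
  \sum_(0 <= k < n) (u k.+1 - u k) * v k =
  u n * v n - u 0%N * v 0%N - \sum_(0 <= k < n) u k.+1 * (v k.+1 - v k).
Proof.
rewrite -(telescope_sumr (fun k => u k * v k)) // -sumrB.
by apply: eq_bigr => k _; rewrite mulrBl mulrBr opprB [RHS]addrC subrKA.
Qed.

Theorem theorem2p3 (R : realType)
  (a1 a2 a3 a4 p1 p2 p3 p4 x1 x2 x3 x4 q1 q2 q3 q4 : R[i])
  (ha1 : a1 != 0) (ha2 : a2 != 0) (ha3 : a3 != 0) (ha4 : a4 != 0)
  (hp1 : p1 != 0) (hp2 : p2 != 0) (hp3 : p3 != 0) (hp4 : p4 != 0)
  (hx1 : x1 != 0) (hx2 : x2 != 0) (hx3 : x3 != 0) (hx4 : x4 != 0)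
  (hq1 : q1 != 0) (hq2 : q2 != 0) (hq3 : q3 != 0) (hq4 : q4 != 0)
  (* fixed square roots: rp_i = p_i^(1/2), rq_i = q_i^(1/2) *)
  (rp1 rp2 rp3 rp4 rq1 rq2 rq3 rq4 : R[i])
  (hrp1 : rp1 ^+ 2 = p1) (hrp2 : rp2 ^+ 2 = p2)
  (hrp3 : rp3 ^+ 2 = p3) (hrp4 : rp4 ^+ 2 = p4)
  (hrq1 : rq1 ^+ 2 = q1) (hrq2 : rq2 ^+ 2 = q2)
  (hrq3 : rq3 ^+ 2 = q3) (hrq4 : rq4 ^+ 2 = q4)
  (n : nat) :
  let K := a1 * a2 * a3 * a4 in
  let L := rp1 * rp2 * rp3 * rp4 in
  let K0 := x1 * x2 * x3 * x4 in
  let L0 := rq1 * rq2 * rq3 * rq4 in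
  let Dx := Dcoef x1 x2 x3 x4 rq1 rq2 rq3 rq4 in
  let Da := Dcoef a1 a2 a3 a4 rp1 rp2 rp3 rp4 in
  let numa := qpoch (a1 ^+ 2 / p1) p1 in
  let numx := qpoch (x1 ^+ 2) q1 in
  let dena := qpoch (K * p2 / (L * a2 ^+ 2)) (L / p2) in
  let denx := qpoch (K0 / x2 ^+ 2) (L0 / q2) in
  (forall m : nat, (m <= n)%N -> dena m != 0 /\ denx m != 0) ->
  a1 / a2 *
    \sum_(0 <= k < n) Da (k%:Z - 1) * (rp1 / rp2) ^ (k%:Z - 1) *
      ((numa k * numx k) / (dena k.+1 * denx k))
  = 1 - (numa n * numx n) / (dena n * denx n)
    - x1 / x2 *
    \sum_(0 <= k < n) Dx k%:Z * (rq1 / rq2) ^ k%:Z *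
      ((numa k.+1 * numx k) / (dena k.+1 * denx k.+1)).
Proof.
move=> K L K0 L0 Dx Da numa numx dena denx den_neq0.
have sqrt_neq0 (r s : R[i]) : r ^+ 2 = s -> s != 0 -> r != 0.
  by move=> <-; rewrite sqrf_eq0.
have rp2_neq0 := sqrt_neq0 _ _ hrp2 hp2.
(* Splitting the exponent [k - 1], which is negative at [k = 0], requires a nonzero base. *)
have L_neq0 : L / p2 != 0.
  rewrite /L !mulf_neq0 ?invr_neq0 //.
  - exact: sqrt_neq0 hrp1 hp1.
  - exact: sqrt_neq0 hrp3 hp3.
  - exact: sqrt_neq0 hrp4 hp4.
(* The shift to [k - 1] leaves the factors [p1^-1] and [(L / p2)^-1]; they are exactly what the
   parameters of [numa] and [dena] absorb. The [x] side has no shift. *)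
have gapa k : a1 / a2 * (Da (k%:Z - 1) * (rp1 / rp2) ^ (k%:Z - 1)) =
    a1 ^+ 2 / p1 * p1 ^+ k - K * p2 / (L * a2 ^+ 2) * (L / p2) ^+ k.
  rewrite Dcoef_factor // hrp1 hrp2 !expfzDr // -!exprnP -/K -/L !exprN1.
  by rewrite invf_div (invfM L); ring.
have gapx k : x1 / x2 * (Dx k%:Z * (rq1 / rq2) ^ k%:Z) =
    x1 ^+ 2 * q1 ^+ k - K0 / x2 ^+ 2 * (L0 / q2) ^+ k.
  by rewrite Dcoef_factor ?(sqrt_neq0 _ _ hrq2) // hrq1 hrq2.
pose U k := numa k / dena k; pose V k := numx k / denx k.
(* [k < n] is [k.+1 <= n], so the hypothesis covers the denominators of index [k.+1]. *)
have diffU k : (k < n)%N -> U k.+1 - U k =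
    - (a1 / a2 * (Da (k%:Z - 1) * (rp1 / rp2) ^ (k%:Z - 1)) *
       (numa k / dena k.+1)).
  by move=> /den_neq0[? _]; rewrite gapa; exact: qpoch_ratio_diff.
have diffV k : (k < n)%N -> V k.+1 - V k =
    - (x1 / x2 * (Dx k%:Z * (rq1 / rq2) ^ k%:Z) * (numx k / denx k.+1)).
  by move=> /den_neq0[_ ?]; rewrite gapx; exact: qpoch_ratio_diff.
have U0V0 : U 0%N * V 0%N = 1.
  by rewrite /U /V /numa /numx /dena /denx /qpoch !big_geq // divr1 mulr1.
have -> : numa n * numx n / (dena n * denx n) = U n * V n.
  by rewrite mulf_div.
rewrite !mulr_sumr -sumrN.
have parts := sum_by_parts _ U V n; rewrite U0V0 in parts.
(* The left-hand sum carries the increments of [U]; summation by parts moves the differences onto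
   [V], which yields the right-hand sum. *)
transitivity (- \sum_(0 <= k < n) (U k.+1 - U k) * V k).
  rewrite -sumrN; apply: eq_big_nat => k /andP[_ lt_kn].
  by rewrite diffU // mulNr opprK -[RHS]mulrA (mulf_div (numa _)) !mulrA.
rewrite parts opprB opprB addrC; congr (_ + _).
apply: eq_big_nat => k /andP[_ lt_kn].
by rewrite diffV // mulrN mulrCA (mulf_div (numa _)) !mulrA.
Qed.
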